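(* Let $F:\mathsf{Comp}\to\mathsf{Comp}$ be a monomorphic functionally continuous functor admitting a tensor product. Then the following conditions are equivalent: (1) the closed interval $[0,1]$ is an absolute $F$-Milutin space; (2) every Tychonoff cube $[0,1]^\kappa$ is an absolute $F$-Milutin space; (3) every compact Hausdorff absolute extensor in dimension $0$ is an absolute $F$-valued retract; (4) the doubleton $\{0,1\}$ is an absolute $F$-valued retract; (5) there are points $a\in F(\{0\})\subset F(\{0,1\})$ and $b\in F(\{1\})\subset F(\{0,1\})$ which can be linked by a continuous path in $F(\{0,1\})$; (6) there is a point $a\in F(\{0\})$ such that for the embeddings $i_0:\{0\}\to\{0\}\subset\{0,1\}$ and $i_1:\{0\}\to\{1\}\subset\{0,1\}$ the points $Fi_0(a)$ and $Fi_1(a)$ can be linked by a continuous path in $F(\{0,1\})$.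
   Context: $\mathsf{Comp}$ is the category of compact Hausdorff spaces and continuous maps; functors are covariant. $F$ is monomorphic if it preserves injective maps. $F$ is functionally continuous if for all compact Hausdorff spaces $X,Y$ the map $C(X,Y)\to C(FX,FY)$, $f\mapsto Ff$, is continuous, where $C(X,Y)$ is the space of continuous maps with the compact-open topology. $F$ admits a tensor product if for each cardinal $\kappa$ and each family $(X_\alpha)_{\alpha\in\kappa}$ of compact Hausdorff spaces there is a continuous map $\otimes_{(X_\alpha)}:\prod_{\alpha\in\kappa}FX_\alpha\to F(\prod_{\alpha\in\kappa}X_\alpha)$ such that for every $\beta\in\kappa$ one has $F\mathrm{pr}_\beta\circ\otimes_{(X_\alpha)}=\mathrm{pr}_\beta$ (where $\mathrm{pr}_\beta$ denotes the coordinate projections $\prod_\alpha X_\alpha\to X_\beta$ and $\prod_\alpha FX_\alpha\to FX_\beta$), and for any continuous maps $f_\alpha:X_\alpha\to Y_\alpha$, $\alpha\in\kappa$, between compact Hausdorff spaces, $F(\prod_\alpha f_\alpha)\circ\otimes_{(X_\alpha)}=\otimes_{(Y_\alpha)}\circ\prod_\alpha Ff_\alpha$. For a closed subset $A\subset X$ with inclusion $i_A^X:A\to X$, ''$a\in FA\subset FX$'' means $a\in Fi_A^X(FA)$. A compact Hausdorff space $X$ is an absolute $F$-valued retract if for any embedding $X\subset Y$ into a compact Hausdorff space $Y$ there is a continuous map $r:Y\to FX$ such that $r(x)\in F(\{x\})\subset FX$ for every $x\in X$. $X$ is absolute $F$-Milutin if there are a continuous surjective map $f:K\to X$ from a Cantor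 cube $K=\{0,1\}^\kappa$ ($\kappa$ a cardinal) and a continuous map $s:X\to FK$ such that $s(x)\in F(f^{-1}(x))\subset FK$ for all $x\in X$. A space $X$ is an absolute extensor in dimension $0$ if each continuous map $f:B\to X$ defined on a closed subspace $B$ of a compact Hausdorff space $A$ with covering dimension $\dim A\le 0$ admits a continuous extension $\bar f:A\to X$. *)

(* Defs.v *)
From HB Require Import structures.
From mathcomp Require Import all_boot all_order all_algebra.
From mathcomp Require Import all_classical all_reals all_analysis homotopy.

Set Implicit Arguments.
Unset Strict Implicit.
Unset Printing Implicit Defensive.

Import Order.TTheory GRing.Theory Num.Theory.
Import numFieldNormedType.Exports.

Local Open Scope classical_set_scope.
Local Open Scope ring_scope.

Record compHaus := CompHaus {
  compHaus_space :> topologicalType;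
  compHaus_compact : compact [set: compHaus_space];
  compHaus_hausdorff : hausdorff_space compHaus_space }.

Section subspaces.
Context {X : topologicalType} (A : set X).

Lemma set_val_continuous : continuous (set_val : A -> X).
Proof. exact: initial_continuous. Qed.

Lemma set_type_hausdorff : hausdorff_space X -> hausdorff_space A.
Proof.
move=> hX p q pq; apply: val_inj; apply: hX => U V pU qV.
have [x [Ux Vx]] := pq _ _ (set_val_continuous pU) (set_val_continuous qV).
by exists (set_val x).
Qed.

Lemma set_type_compact : compact A -> compact [set: A].
Proof.
move=> cA F PF _.
have FA : (set_val @ F) A by apply: (@filterE _ F) => z; exact: set_valP.
have [x [Ax Fx]] := cA _ (fmap_proper_filter _ PF) FA.
exists (exist _ x (mem_set Ax)); split => // P Q FP.
case=> _ [[W oW <-] Wx] WQ.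
have [|_ [[z Pz <-] Wz]] := Fx (set_val @` P) W _ (open_nbhs_nbhs (conj oW Wx)).
  by rewrite /fmap /=; apply: filterS FP => z Pz; exists z.
by exists z; split => //; exact: WQ.
Qed.

End subspaces.

Section products.
Context (I : Type).

Lemma prod_compact (X : I -> compHaus) :
  compact [set: prod_topology (fun i => X i)].
Proof.
have := @tychonoff {classic I} X _ (fun i => @compHaus_compact (X i)).
by congr (compact _); rewrite eqEsubset.
Qed.

Lemma prod_hausdorff (X : I -> compHaus) :
  hausdorff_space (prod_topology (fun i => X i)).
Proof.
by apply: (@hausdorff_product {classic I}) => i; exact: compHaus_hausdorff.
Qed.

Definition prod_compHaus (X : I -> compHaus) : compHaus :=
  CompHaus (@prod_compact X) (@prod_hausdorff X).

Definition prod_map (X Y : I -> compHaus)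
    (f : forall i, continuousType (X i) (Y i)) (x : prod_compHaus X) :
    prod_compHaus Y :=
  fun i => f i (x i).

Lemma prod_compHaus_proj_continuous (X : I -> compHaus) (i : I) :
  continuous ((fun x => x i) : prod_compHaus X -> X i).
Proof. exact: (@proj_continuous {classic I} X i). Qed.

Lemma prod_map_continuous (X Y : I -> compHaus)
    (f : forall i, continuousType (X i) (Y i)) :
  continuous (prod_map f).
Proof.
move=> x; have ? : Filter (prod_map f @ nbhs x).
  exact: fmap_filter.
apply/cvg_sup => i U [_ [[W oW <-] Wx] WU].
have Wfx : nbhs (x i) (f i @^-1` W).
  by apply: (@cts_fun _ _ (f i)); exact: open_nbhs_nbhs.
have Wx' : nbhs x [set y : prod_compHaus X | W (f i (y i))].
  exact: (@prod_compHaus_proj_continuous X i x _ Wfx).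
change (nbhs x (prod_map f @^-1` U)).
by apply: filterS Wx' => y Wy; exact: WU.
Qed.

HB.instance Definition _ (X Y : I -> compHaus)
    (f : forall i, continuousType (X i) (Y i)) :=
  isContinuous.Build (prod_compHaus X) (prod_compHaus Y) (prod_map f)
    (@prod_map_continuous X Y f).

Definition prod_compHaus_proj (X : I -> compHaus) (i : I) :
    continuousType (prod_compHaus X) (X i) :=
  mkcts (@prod_compHaus_proj_continuous X i).

End products.

Section closed_subspaces.
Context {X : compHaus}.

Lemma sub_compHaus_compact (A : set X) : closed A -> compact [set: A].
Proof.
move=> cA; apply: set_type_compact.
exact: subclosed_compact cA (@compHaus_compact X) _.
Qed.

Definition sub_compHaus (A : set X) (cA : closed A) : compHaus :=
  CompHaus (sub_compHaus_compact cA)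
    (set_type_hausdorff (@compHaus_hausdorff X)).

Definition sub_incl (A : set X) (cA : closed A) :
    continuousType (sub_compHaus cA) X :=
  mkcts (@set_val_continuous X A).

Lemma closed_point (x : X) : closed [set x].
Proof.
exact/accessible_closed_set1/hausdorff_accessible/compHaus_hausdorff.
Qed.

Lemma closed_fiber (Y : compHaus) (f : continuousType Y X) (x : X) :
  closed (f @^-1` [set x]).
Proof.
apply: preimage_closed; last exact: closed_point.
by move=> y _; exact: (@cts_fun _ _ f). Qed.

End closed_subspaces.

Arguments closed_point {X} x.
Arguments closed_fiber {X Y} f x.

(* {0, 1} is bool with its discrete topology; false is 0 and true is 1. *)
Definition doubleton : compHaus := CompHaus bool_compact discrete_hausdorff.

Definition unit_interval (R : realType) : Type :=
  set_type (`[0, 1]%classic : set R).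

HB.instance Definition _ (R : realType) := Topological.on (unit_interval R).

Section unit_interval.
Context (R : realType).

Let mem0 : (0 : R) \in (`[0, 1]%classic : set R).
Proof. by rewrite inE/= bound_itvE. Qed.

Let mem1 : (1 : R) \in (`[0, 1]%classic : set R).
Proof. by rewrite inE/= bound_itvE. Qed.

Definition itv0 : unit_interval R := exist _ 0 mem0.
Definition itv1 : unit_interval R := exist _ 1 mem1.

Lemma itv0_neq_itv1 : itv0 != itv1.
Proof. by apply/eqP => -[] /esym/eqP; rewrite oner_eq0. Qed.

HB.instance Definition _ :=
  isBiPointed.Build (unit_interval R) itv0_neq_itv1.

Definition itv_compHaus : compHaus :=
  @CompHaus (unit_interval R) (set_type_compact (@segment_compact R 0 1))
    (set_type_hausdorff (@Rhausdorff R)).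

Definition path_linked (X : topologicalType) (a b : X) : Prop :=
  $|{path unit_interval R from a to b}|.

End unit_interval.

Definition cantor_cube (I : Type) : compHaus :=
  prod_compHaus (fun _ : I => doubleton).

Definition tychonoff_cube (R : realType) (I : Type) : compHaus :=
  prod_compHaus (fun _ : I => itv_compHaus R).

Record compFunctor := CompFunctor {
  functor_obj :> compHaus -> compHaus;
  functor_map : forall X Y : compHaus, continuousType X Y ->
           continuousType (functor_obj X) (functor_obj Y);
  functor_map_id : forall X : compHaus,
    functor_map (idfun : continuousType X X) =1 idfun;
  functor_map_comp : forall (X Y Z : compHaus)
    (f : continuousType X Y) (g : continuousType Y Z),
    functor_map (g \o f : continuousType X Z) =1
    functor_map g \o functor_map f }.

Arguments functor_map F {X Y} f : rename.

Definition monomorphic (F : compFunctor) : Prop :=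
  forall (X Y : compHaus) (f : continuousType X Y),
    injective f -> injective (functor_map F f).

(* C(X, Y) with the topology induced by the compact-open topology on all
   functions; the library puts no canonical topology on continuousType. *)
Definition C_co (X Y : topologicalType) : topologicalType :=
  initial_topology (id : continuousType X Y -> {compact-open, X -> Y}).

Definition functionally_continuous (F : compFunctor) : Prop :=
  forall X Y : compHaus,
    continuous (functor_map F : C_co X Y -> C_co (F X) (F Y)).

(* Families indexed by a cardinal are families indexed by an arbitrary type. *)
Definition admits_tensor_product (F : compFunctor) : Prop :=
  exists tensor : forall (I : Type) (X : I -> compHaus),
      continuousType (prod_compHaus (fun i => F (X i))) (F (prod_compHaus X)),
    (forall (I : Type) (X : I -> compHaus) (j : I),
       functor_map F (prod_compHaus_proj X j) \o tensor I X =1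
       prod_compHaus_proj (fun i => F (X i)) j) /\
    (forall (I : Type) (X Y : I -> compHaus)
        (f : forall i, continuousType (X i) (Y i)),
       functor_map F (prod_map f) \o tensor I X =1
       tensor I Y \o prod_map (fun i => functor_map F (f i))).

(* "a \in FA" for a closed A `<=` X, where FA is identified with its image
   under F(i_A^X) in FX. *)
Definition Fsub (F : compFunctor) (X : compHaus) (A : set X) (cA : closed A) :
    set (F X) :=
  range (functor_map F (sub_incl cA)).

Arguments Fsub F {X A} cA _.

Definition embedding (X Y : topologicalType) (e : X -> Y) : Prop :=
  [/\ continuous e, injective e
    & forall U : set X, open U -> exists2 V : set Y, open V & U = e @^-1` V].

Definition absolute_valued_retract (F : compFunctor) (X : compHaus) : Prop :=
  forall (Y : compHaus) (e : X -> Y), embedding e ->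
  exists r : continuousType Y (F X),
    forall x : X, Fsub F (closed_point x) (r (e x)).

Definition absolute_Milutin (F : compFunctor) (X : compHaus) : Prop :=
  exists (I : Type) (f : continuousType (cantor_cube I) X)
      (s : continuousType X (F (cantor_cube I))),
    (forall x : X, exists k, f k = x) /\
    (forall x : X, Fsub F (closed_fiber f x) (s x)).

(* Covers are indexed families. Counting repeated members of V is harmless:
   repetitions can be discarded from the refinement. *)
Definition covering_dim_le (n : nat) (X : topologicalType) : Prop :=
  forall (k : nat) (U : 'I_k -> set X),
    (forall i, open (U i)) -> \bigcup_i U i = setT ->
  exists (m : nat) (V : 'I_m -> set X),
    [/\ forall j, open (V j), \bigcup_j V j = setT,
        forall j, exists i, V j `<=` U i
      & forall x : X, (#|[pred j | `[< V j x >]]| <= n.+1)%N].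

Definition absolute_extensor0 (X : topologicalType) : Prop :=
  forall (A : compHaus) (B : set A) (cB : closed B), covering_dim_le 0 A ->
  forall f : continuousType (sub_compHaus cB) X,
  exists g : continuousType A X,
    forall b : sub_compHaus cB, g (sub_incl cB b) = f b.

(* Main.v *)
Require Import Defs.
From mathcomp Require Import all_boot all_order all_algebra.
From mathcomp Require Import all_classical all_reals all_analysis homotopy.
From mathcomp Require Import lra.

(* The tensor product turns selections of points of the spaces F(X_i) with
   supports in sets A_i into a point of F(prod X_i) supported in prod A_i. This
   gives (1) => (2) directly. For (2) => (3), embed Y in a Tychonoff cube with
   Milutin map f : K -> [0,1]^I, extend f^-1(X) -> X to g : K -> X using
   dim K = 0, and compose Fg with the selection. For (5) => (6), the path from
   F{0} to F{1} is projected to F{0} and followed by the reversed image of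
   itself under the swap of 0 and 1.

   For (6) => (1), read x in [0,1] by descending a binary tree of intervals in
   which the children of a node are its left and right two thirds. Put an
   independent bit at every node of the tree: its law is the position, on the
   path from F{0} to F{1}, given by a function of x that is 0 on the left third
   of the node and 1 on the right third, so that following a possible bit never
   leaves x behind. The tensor product of these laws depends continuously on x
   and is supported in the bit assignments whose branch converges to x. *)

Set Implicit Arguments.
Unset Strict Implicit.
Unset Printing Implicit Defensive.

Import Order.TTheory GRing.Theory Num.Theory.
Import numFieldNormedType.Exports.

Local Open Scope classical_set_scope.

(** * Continuity of maps into subspaces, products and compact spaces *)

Lemma continuous_set_type (X Y : topologicalType) (A : set Y) (f : X -> A) :
  continuous (set_val \o f) -> continuous f.
Proof. exact: continuous_comp_initial. Qed.

Lemma continuous_prod (X : topologicalType) (I : Type) (Y : I -> compHaus)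
    (f : X -> prod_compHaus Y) :
  (forall i, continuous (fun x => f x i)) -> continuous f.
Proof.
move=> cf x; have ? : Filter (f @ nbhs x) by exact: fmap_filter.
apply/cvg_sup => i U [_ [[W oW <-] Wx] WU].
have : nbhs x ((fun x => f x i) @^-1` W) by apply: cf; exact: open_nbhs_nbhs.
change (nbhs x ((fun x => f x i) @^-1` W) -> nbhs x (f @^-1` U)).
by apply: filterS => y Wy; exact: WU.
Qed.

Lemma compact_lift_continuous (X Z : compHaus) (B : topologicalType)
    (j : continuousType X Z) (g : B -> X) :
  injective j -> continuous (j \o g) -> continuous g.
Proof.
move=> j_inj cjg; apply/continuous_closedP => D cD.
have -> : g @^-1` D = (j \o g) @^-1` (j @` D).
  by apply/seteqP; split => b /=; [exists (g b)|move=> [x Dx /j_inj <-]].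
have cjD : compact (j @` D).
  apply: continuous_compact; first exact/continuous_subspaceT/cts_fun.
  exact: subclosed_compact cD (@compHaus_compact X) _.
apply: (iffLR (continuous_closedP _)) => //.
exact: compact_closed (@compHaus_hausdorff Z) cjD.
Qed.

(** * Calculus of supports: the relation a ∈ FA under maps and tensor products *)

Section functors.
Variable F : compFunctor.

Lemma functor_map_compE (X Y Z : compHaus) (f : continuousType X Y)
    (g : continuousType Y Z) (h : continuousType X Z) :
  h =1 g \o f -> functor_map F h =1 functor_map F g \o functor_map F f.
Proof.
move=> hgf x; rewrite -functor_map_comp; congr (functor_map F _ x).
exact/continuousEP.
Qed.

Lemma functor_map_idE (X : compHaus) (f : continuousType X X) :
  f =1 id -> functor_map F f =1 id.
Proof.
move=> fid x; rewrite -[RHS](@functor_map_id F _).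
by congr (functor_map F _ x); exact/continuousEP.
Qed.

(** [f] restricts to a continuous map [g] from [A] to [B]; functoriality turns the commuting square
    of [f], [g] and the two inclusions into the claim. *)
Lemma Fsub_map (X Y : compHaus) (f : continuousType X Y) (A : set X)
    (cA : closed A) (B : set Y) (cB : closed B) (c : F X) :
  (forall x, A x -> B (f x)) -> Fsub F cA c -> Fsub F cB (functor_map F f c).
Proof.
move=> fAB [t _ <-].
pose g (x : sub_compHaus cA) : sub_compHaus cB :=
  exist _ (f (val x)) (mem_set (fAB _ (set_valP x))).
have cg : continuous g.
  by apply: continuous_set_type; exact: (@cts_fun _ _ (f \o sub_incl cA)).
exists (functor_map F (mkcts cg) t) => //.
rewrite -[LHS]/((functor_map F _ \o functor_map F _) t).
rewrite -[RHS]/((functor_map F _ \o functor_map F _) t).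
by rewrite -(functor_map_compE (h := f \o sub_incl cA)) // -functor_map_comp.
Qed.

Lemma Fsub_subset (X : compHaus) (A B : set X) (cA : closed A) (cB : closed B)
    (c : F X) :
  A `<=` B -> Fsub F cA c -> Fsub F cB c.
Proof.
move=> AB Ac; rewrite -[c](@functor_map_id F _).
exact: Fsub_map Ac.
Qed.

Lemma Fsub_full (X : compHaus) (A : set X) (cA : closed A) (c : F X) :
  (forall x, A x) -> Fsub F cA c.
Proof.
move=> AT; pose g (x : X) : sub_compHaus cA := exist _ x (mem_set (AT x)).
have cg : continuous g by apply: continuous_set_type => x; exact: cvg_id.
exists (functor_map F (mkcts cg) c) => //.
rewrite -[LHS]/((functor_map F _ \o functor_map F _) c) -functor_map_comp.
by rewrite functor_map_idE.
Qed.

Lemma Fsub_map_range (X Y : compHaus) (f : continuousType X Y) (B : set Y)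
    (cB : closed B) (c : F X) :
  (forall x, B (f x)) -> Fsub F cB (functor_map F f c).
Proof.
by move=> fB; apply: (Fsub_map (cA := closedT)) => //; exact: Fsub_full.
Qed.

(** Lift each [c i] to F(A_i) and tensor the lifts; naturality for the inclusions A_i → X_i exhibits
    the result as an image under a map with values in [C]. A general closed [C] lets fibres of maps
    be used directly. *)
Lemma Fsub_tensor
    (tensor : forall (I : Type) (X : I -> compHaus),
      continuousType (prod_compHaus (fun i => F (X i))) (F (prod_compHaus X)))
    (tensor_nat : forall (I : Type) (X Y : I -> compHaus)
        (f : forall i, continuousType (X i) (Y i)),
       functor_map F (prod_map f) \o tensor I X =1
       tensor I Y \o prod_map (fun i => functor_map F (f i)))
    (I : Type) (X : I -> compHaus) (A : forall i, set (X i))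
    (cA : forall i, closed (A i)) (C : set (prod_compHaus X)) (cC : closed C)
    (c : prod_compHaus (fun i => F (X i))) :
  (forall y : prod_compHaus X, (forall i, A i (y i)) -> C y) ->
  (forall i, Fsub F (cA i) (c i)) -> Fsub F cC (tensor I X c).
Proof.
move=> AC Ac.
pose t : prod_compHaus (fun i => F (sub_compHaus (cA i))) :=
  fun i => s2val (cid2 (Ac i)).
have -> : c = prod_map (fun i => functor_map F (sub_incl (cA i))) t.
  apply: functional_extensionality_dep => i.
  exact/esym/(s2valP' (cid2 (Ac i))).
rewrite -[tensor _ _ _]/((tensor I X \o prod_map _) t) -tensor_nat /=.
by apply: Fsub_map_range => y; apply: AC => i; exact: set_valP.
Qed.

End functors.

(** * Covering dimension zero and extension of two-valued maps *)

Lemma covering_dim_zero_dimensional (X : compHaus) :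
  zero_dimensional X -> covering_dim_le 0 X.
Proof.
move=> zX k U oU UT.
have /choice [C CP] : forall x : X, exists C : set X,
    [/\ clopen C, C x & exists i, C `<=` U i].
  move=> x; have [i _ Uix] : (\bigcup_i U i) x by rewrite UT.
  have [|C [Cx cC] CU] := @zero_dimensional_cvg X x
    (@compHaus_hausdorff X) zX (@compHaus_compact X) (U i).
    exact: open_nbhs_nbhs.
  by exists C; split => //; exists i.
have [D DT] : exists D : seq X, forall x, exists2 y, y \in D & C y x.
  (* Finite lists are filtered by inclusion, so the near-covering form of compactness yields one
     list [D] that serves all points at once. *)
  pose G := filter_from [set: seq X]
    (fun D => [set D' : seq X | {subset D <= D'}]).
  have GF : Filter G.
    apply: filter_from_filter; first by exists [::].
    move=> D1 D2 _ _; exists (D1 ++ D2) => // D' D'P.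
    by split=> x xD; apply: D'P; rewrite mem_cat xD ?orbT.
  have := iffLR (compact_near_coveringP _) (@compHaus_compact X).
  move=> /(_ _ G (fun D x => exists2 y, y \in D & C y x) GF) [x _|D _ DT].
    have [[oC _] Cx _] := CP x.
    exists (C x, [set D' : seq X | {subset [:: x] <= D'}]); first split.
    - exact: open_nbhs_nbhs.
    - by exists [:: x].
    - move=> [y D'] /= [Cxy xD']; exists x => //.
      by apply: xD'; exact: mem_head.
  by exists D => x; exact: (DT D (fun _ => id)) x I.
pose c (j : 'I_(size D)) : set X := C (tnth (in_tuple D) j).
(* Removing the earlier members makes the clopen cover disjoint; since they are finitely many, the
   differences stay open. *)
pose V (j : 'I_(size D)) :=
  c j `\` \bigcup_(l in [set l : 'I_(size D) | (l < j)%N]) c l.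
have Vinj (x : X) (i j : 'I_(size D)) : V i x -> V j x -> i = j.
  move=> [ci ni] [cj nj]; apply/val_inj; case: (ltngtP i j) => // ij.
    by case: nj; exists i.
  by case: ni; exists j.
exists (size D), V; split.
- move=> j; rewrite /V setDE; apply: openI.
    by have [[]] := CP (tnth (in_tuple D) j).
  apply: closed_openC; apply: closed_bigcup => [|l _].
    exact: finite_finset.
  by have [[]] := CP (tnth (in_tuple D) l).
- apply/seteqP; split => // x _.
  have [y yD Cyx] := DT x.
  have /tnthP[j0 yE] : y \in in_tuple D by exact: yD.
  have cj0 : `[< c j0 x >] by apply/asboolP; rewrite /c -yE.
  (* The least index whose clopen set contains [x] survives the removal. *)
  have [j /asboolP cj jmin] :=
    @arg_minnP _ j0 (fun j => `[< c j x >]) (fun j => j : nat) cj0.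
  exists j => //; split=> // -[l /= lj /asboolP/jmin].
  by rewrite leqNgt lj.
- move=> j; have [_ _ [i Ci]] := CP (tnth (in_tuple D) j).
  by exists i; apply: subset_trans Ci; exact: subDsetl.
- move=> x; apply/card_le1_eqP => i j /asboolP Vi /asboolP Vj.
  exact: Vinj Vj Vi.
Qed.

Lemma cantor_cube_dim0 (I : Type) : covering_dim_le 0 (cantor_cube I).
Proof.
apply: covering_dim_zero_dimensional.
apply: (@zero_dimension_prod {classic I}) => _.
exact: discrete_zero_dimension.
Qed.

(** The two fibres of [f] are disjoint closed sets in [A]. A disjoint open refinement of the cover
    by their complements has no member meeting both, so the members meeting the [true] fibre unite
    to a clopen set that separates them; its indicator extends [f]. *)
Lemma doubleton_AE0 : absolute_extensor0 doubleton.
Proof.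
move=> A B cB dimA f.
pose S b : set A := sub_incl cB @` (f @^-1` [set b]).
have cS b : closed (S b).
  apply: compact_closed; first exact: compHaus_hausdorff.
  apply: continuous_compact; first exact/continuous_subspaceT/cts_fun.
  apply: subclosed_compact (@compHaus_compact (sub_compHaus cB)) _ => //.
  exact: closed_fiber.
have S01 x : S false x -> S true x -> False.
  move=> [y fy <-] [z fz] /val_inj yz; move: fy fz; rewrite yz /= => -> //.
(* Index 0 stands for the complement of [S true], index 1 for that of [S false]. *)
have [||m [V [oV VT VU V1]]] := dimA 2 (fun i => ~` S (i == ord0)).
- by move=> i; exact: closed_openC.
- apply/seteqP; split => // x _.
  have [Sx|Sx] := pselect (S true x); last by exists ord0.
  by exists (lift ord0 ord0) => // Sx'; exact: S01 Sx' Sx.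
pose W := \bigcup_(j in [set j | V j `&` S true !=set0]) V j.
have Vinj (x : A) i j : V i x -> V j x -> i = j.
  move=> Vi Vj; apply/esym; move/card_le1_eqP: (V1 x); apply; exact/asboolP.
have WC : ~` W = \bigcup_(j in [set j | ~ (V j `&` S true !=set0)]) V j.
  apply/seteqP; split=> x.
    move=> nWx; have [j _ Vx] : (\bigcup_j V j) x by rewrite VT.
    by exists j => // Vj; apply: nWx; exists j.
  by move=> [j nj Vx] [i ni Vx']; apply: nj; rewrite (Vinj _ _ _ Vx Vx').
have cW : clopen W.
  split; first by apply: bigcup_open => j _.
  by rewrite -openC WC; apply: bigcup_open => j _.
pose g (x : A) : doubleton := `[< W x >].
have cg : continuous g.
  apply/continuousP => Q _.
  have -> : g @^-1` Q =
      (W `&` [set x | Q true]) `|` (~` W `&` [set x | Q false]).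
    apply/seteqP; split => x; rewrite /g /=.
      by case: asboolP => Wx ?; [left|right].
    by case; case: asboolP => [?|?] [].
  have oc (P : Prop) : @open A [set x | P].
    have [p|p] := pselect P.
      rewrite (_ : [set _ | _] = setT); first exact: openT.
      by apply/seteqP; split.
    rewrite (_ : [set _ | _] = set0); first exact: open0.
    by apply/seteqP; split.
  apply: openU; apply: openI => //; first by case: cW.
  by apply: closed_openC; case: cW.
exists (mkcts cg) => b.
have [j _ Vb] : (\bigcup_j V j) (sub_incl cB b) by rewrite VT.
have Sb : S (f b) (sub_incl cB b) by exists b.
rewrite -[LHS]/(`[< W (sub_incl cB b) >]).
case: asboolP; case: (f b) Sb => Sb //.
(* Here [f b] is [false]: the member containing [b] would meet both [S true] and [S false], yet it
   avoids one of them. *)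
- move=> [i [x [Vx Sx]] Vi]; have [l Vl] := VU j.
  move: Vx; rewrite (Vinj _ _ _ Vi Vb) => /Vl.
  by have := Vl _ Vb; case: (l == ord0).
- by case; exists j => //; exists (sub_incl cB b).
Qed.

(** * Embedding into Tychonoff cubes, with one coordinate for each continuous function to [0,1] *)

Lemma tychonoff_embedding (R : realType) (Y : compHaus) :
  exists (I : Type) (h : continuousType Y (tychonoff_cube R I)), injective h.
Proof.
exists (continuousType Y (itv_compHaus R)).
pose h (y : Y) : tychonoff_cube R (continuousType Y (itv_compHaus R)) :=
  fun u => u y.
have ch : continuous h by apply: continuous_prod => u; exact: cts_fun.
exists (mkcts ch) => x y hxy; apply: contrapT => xy.
(* Compact Hausdorff spaces are normal, so a Urysohn function tells [x] from [y]; it is one of the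
   coordinates of [h]. *)
have : @uniform_separator Y [set x] [set y].
  apply: (iffLR (normal_separatorP (R := R))).
  - exact: compact_normal (@compHaus_hausdorff Y) (@compHaus_compact Y).
  - exact: closed_point.
  - exact: closed_point.
  - by rewrite -subset0 => z [-> /xy].
move=> /[dup] /(Urysohn_sub0 (R := R)) u0 /(Urysohn_sub1 (R := R)) u1.
have ur z : (Urysohn [set x] [set y] z : R) \in (`[0%R, 1%R]%classic : set R).
  by rewrite inE; apply: Urysohn_range; exists z.
pose u (z : Y) : itv_compHaus R := SigSub (ur z).
have cu : continuous u.
  by apply: continuous_set_type; exact: Urysohn_continuous.
have /(congr1 val) : h x (mkcts cu) = h y (mkcts cu).
  by rewrite (hxy : h x = h y).
rewrite /mkcts /h /= (u0 (Urysohn [set x] [set y] x)); last by exists x.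
rewrite (u1 (Urysohn [set x] [set y] y)); last by exists y.
by move/esym/eqP; rewrite oner_eq0.
Qed.

(** * The implications (1) => (2) and (2) => (3) *)

Section implications.
Variable F : compFunctor.

(** The product of the Milutin maps is again one, with the tensor product of the selections as
    selection. Currying identifies the product of the Cantor cubes with a single cube indexed by
    pairs. *)
Lemma Milutin_prod (I : Type) (X : I -> compHaus) :
  admits_tensor_product F -> (forall i, absolute_Milutin F (X i)) ->
  absolute_Milutin F (prod_compHaus X).
Proof.
move=> [tensor [_ tensor_nat]] MX.
pose J i := projT1 (cid (MX i)).
pose f i := projT1 (cid (projT2 (cid (MX i)))).
pose s i := projT1 (cid (projT2 (cid (projT2 (cid (MX i)))))).
have fsurj i : forall x, exists k, f i k = x.
  by have [] := projT2 (cid (projT2 (cid (projT2 (cid (MX i)))))).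
have sF i : forall x, Fsub F (closed_fiber (f i) x) (s i x).
  by have [] := projT2 (cid (projT2 (cid (projT2 (cid (MX i)))))).
pose K := prod_compHaus (fun i => cantor_cube (J i)).
pose curry (k : cantor_cube {i & J i}) : K := fun i j => k (existT _ i j).
have curry_cont : continuous curry.
  apply: continuous_prod => i; apply: continuous_prod => j.
  exact: prod_compHaus_proj_continuous.
pose uncurry (k : K) : cantor_cube {i & J i} :=
  fun p => k (projT1 p) (projT2 p).
have uncurry_cont : continuous uncurry.
  apply: continuous_prod => p.
  exact: (@cts_fun _ _ (prod_compHaus_proj _ (projT2 p) \o
                        prod_compHaus_proj _ (projT1 p))).
have uncurryK (k : K) : curry (uncurry k) = k by [].
exists {i & J i}, (prod_map f \o mkcts curry_cont),
  (functor_map F (mkcts uncurry_cont) \o (tensor I _ \o prod_map s)); split=> x.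
  exists (uncurry (fun i => projT1 (cid (fsurj i (x i))))) => /=.
  apply: functional_extensionality_dep => i.
  exact: (projT2 (cid (fsurj i (x i)))).
apply: (Fsub_map (cA := closed_fiber (prod_map f) x)) => [k <- //|].
apply: (Fsub_tensor tensor_nat (cA := fun i => closed_fiber (f i) (x i))).
  by move=> k fk; apply: functional_extensionality_dep => i; exact: fk.
by move=> i; exact: sF.
Qed.

Lemma Milutin_cube_valued_retract (R : realType) :
  (forall I, absolute_Milutin F (tychonoff_cube R I)) ->
  forall X : compHaus, absolute_extensor0 X -> absolute_valued_retract F X.
Proof.
move=> MR X XAE Y e [ce e_inj _].
have [I [h h_inj]] := tychonoff_embedding R Y.
have [J [f [s [fsurj sF]]]] := MR I.
pose j : continuousType X (tychonoff_cube R I) := h \o mkcts ce.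
have j_inj : injective j by move=> x y /h_inj /e_inj.
have cB : closed (f @^-1` range j).
  apply: preimage_closed; first by move=> x _; exact: cts_fun.
  apply: compact_closed; first exact: compHaus_hausdorff.
  apply: continuous_compact; last exact: compHaus_compact.
  exact/continuous_subspaceT/cts_fun.
(* [g] is [f] followed by the inverse of [j] on its range. Its extension [G] sends the whole fibre
   of [f] over [j x] to [x], which puts the value of the retraction in F{x}. *)
pose g (b : sub_compHaus cB) : X := s2val (cid2 (set_valP b)).
have jg b : j (g b) = f (val b) := s2valP' (cid2 (set_valP b)).
have cg : continuous g.
  apply: (@compact_lift_continuous X _ _ j g j_inj).
  rewrite (_ : j \o g = f \o sub_incl cB); first exact: cts_fun.
  by apply/funext => b; exact: jg.
have [G GE] := XAE _ _ cB (@cantor_cube_dim0 J) (mkcts cg).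
exists (functor_map F G \o (s \o h)) => x.
apply: (Fsub_map (cA := closed_fiber f (j x))) => [k fk|]; last exact: sF.
have kB : (f @^-1` range j) k by exists x.
have := GE (SigSub (mem_set kB)); rewrite /= => ->.
by apply: j_inj; rewrite [LHS]jg.
Qed.

End implications.

Local Open Scope ring_scope.

(** * Reparametrization, reversal and concatenation of paths *)

Section interval.
Variable R : realType.

Lemma clamp_subproof (z : R) :
  Num.max 0 (Num.min 1 z) \in (`[0, 1]%classic : set R).
Proof.
by rewrite inE /= in_itv /= le_max lexx ge_max ler01 ge_min lexx.
Qed.

(** The retraction of the line onto [0,1]; it makes every affine reparametrization of a path
    total. *)
Definition clamp (z : R) : itv_compHaus R := SigSub (clamp_subproof z).

Lemma clamp_continuous : continuous clamp.
Proof.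
apply: continuous_set_type => z /=.
apply: continuous_max; first exact: cvg_cst.
by apply: continuous_min; [exact: cvg_cst|exact: cvg_id].
Qed.

Lemma clamp0 z : z <= 0 -> clamp z = itv0 R.
Proof.
move=> z0; apply: val_inj => /=.
by rewrite (min_idPr _) ?(max_idPl _) // (le_trans z0) // ler01.
Qed.

Lemma clamp1 z : 1 <= z -> clamp z = itv1 R.
Proof.
move=> z1; apply: val_inj => /=.
by rewrite (min_idPl _) ?(max_idPr _) // ler01.
Qed.

Lemma val_itv_continuous : continuous (val : itv_compHaus R -> R).
Proof. exact: set_val_continuous. Qed.

Lemma affine_clamp_continuous (a b : R) :
  continuous (fun t : itv_compHaus R => clamp (a * val t + b)).
Proof.
have cf : continuous (fun z : R => a * z + b).
  move=> z; apply: continuousD; last exact: cvg_cst.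
  by apply: continuousM; [exact: cvg_cst|exact: cvg_id].
have cg : continuous (clamp \o (fun z : R => a * z + b)).
  by move=> z; apply: continuous_comp; [exact: cf|exact: clamp_continuous].
by move=> t; exact: (continuous_comp (@val_itv_continuous t) (cg _)).
Qed.

Lemma path_linkedP (X : topologicalType) (a b : X) :
  path_linked R a b <->
  exists p : continuousType (itv_compHaus R) X,
    p (itv0 R) = a /\ p (itv1 R) = b.
Proof.
split=> [[p]|[p [p0 p1]]].
  have cp : continuous (p : itv_compHaus R -> X) by exact: cts_fun.
  have p0 : p zero = a := path_zero.
  have p1 : p one = b := path_one.
  by exists (mkcts cp); split; [exact: p0|exact: p1].
have cp : continuous (p : unit_interval R -> X) by exact: cts_fun.
exact: (squash (mk_path cp p0 p1 : {path _ from _ to _})).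
Qed.

Lemma path_linked_sym (X : topologicalType) (a b : X) :
  path_linked R a b -> path_linked R b a.
Proof.
move/path_linkedP => [p [p0 p1]]; apply/path_linkedP.
exists (p \o mkcts (@affine_clamp_continuous (-1) 1)).
split.
- by rewrite -[LHS]/(p (clamp (-1 * 0 + 1))) clamp1 // mulr0 add0r.
- by rewrite -[LHS]/(p (clamp (-1 * 1 + 1))) clamp0 // mulr1 addNr.
Qed.

Lemma path_linked_trans (X : topologicalType) (a b c : X) :
  path_linked R a b -> path_linked R b c -> path_linked R a c.
Proof.
move=> /path_linkedP [p [p0 p1]] /path_linkedP [q [q0 q1]]; apply/path_linkedP.
pose p' : continuousType (itv_compHaus R) X :=
  p \o mkcts (@affine_clamp_continuous 2 0).
pose q' : continuousType (itv_compHaus R) X :=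
  q \o mkcts (@affine_clamp_continuous 2 (-1)).
pose w (t : itv_compHaus R) := if val t <= 2^-1 then p' t else q' t.
have pq (t : itv_compHaus R) : val t = 2^-1 -> p' t = q' t.
  move=> tE; rewrite -[LHS]/(p (clamp (2 * val t + 0))) tE clamp1; last by lra.
  rewrite -[RHS]/(q (clamp (2 * val t + -1))) tE clamp0; last by lra.
  by rewrite p1.
have cw : continuous w.
  (* Pasting: each closed half contributes a closed set, and the halves agree at 1/2 by [pq]. *)
  apply/continuous_closedP => C cC.
  have -> : w @^-1` C = (val @^-1` [set z | z <= 2^-1] `&` p' @^-1` C) `|`
                        (val @^-1` [set z | 2^-1 <= z] `&` q' @^-1` C).
    apply/seteqP; split=> t; rewrite /w /=; case: ifPn => tle.
    + by left.
    + by right; split=> //; apply/ltW; rewrite ltNge.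
    + case=> [[]//|[tge Cq]]; change (C (p' t)).
      by rewrite pq //; apply/eqP; rewrite eq_le tle.
    + by case=> [[tle' _]|[]//]; case/negP: tle.
  apply: closedU; apply: closedI;
    apply: (iffLR (continuous_closedP _)) => //;
    first [exact: val_itv_continuous | exact: cts_fun
          | exact: closed_le | exact: closed_ge].
exists (mkcts cw); split.
- rewrite -[LHS]/(w (itv0 R)) /w ifT; last by rewrite /= invr_ge0 ler0n.
  by rewrite -[LHS]/(p (clamp (2 * 0 + 0))) clamp0 // mulr0 addr0.
- rewrite -[LHS]/(w (itv1 R)) /w ifF; last first.
    by apply/negbTE; rewrite -ltNge /=; lra.
  by rewrite -[LHS]/(q (clamp (2 * 1 + -1))) clamp1 //; lra.
Qed.

Lemma path_linked_map (X Y : topologicalType) (f : continuousType X Y)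
    (a b : X) :
  path_linked R a b -> path_linked R (f a) (f b).
Proof.
move/path_linkedP => [p [<- <-]]; apply/path_linkedP.
by exists (f \o p).
Qed.

End interval.

(** * The implications (4) => (5) and (5) => (6) *)

Section implications.
Variables (R : realType) (F : compFunctor).

(** Embed {0,1} as the endpoints of [0,1]; the map [r] given by the retract property is then itself
    the path. *)
Lemma doubleton_retract_path :
  absolute_valued_retract F doubleton ->
  exists a b : F doubleton,
    [/\ Fsub F (closed_point (false : doubleton)) a,
        Fsub F (closed_point (true : doubleton)) b
      & path_linked R a b].
Proof.
pose e (b : doubleton) : itv_compHaus R := if b then itv1 R else itv0 R.
have ce : continuous e.
  by apply/continuousP => U _; exact: (@discrete_open bool).
have e_inj : injective e.
  move=> [] [] // /(congr1 val) /eqP; rewrite /= ?oner_eq0 //.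
  by rewrite eq_sym oner_eq0.
move/(_ _ e) => [|r rE].
  split=> // U _; exists (~` (e @` ~` U)).
    apply: closed_openC; apply: compact_closed; first exact: compHaus_hausdorff.
    apply: continuous_compact; first exact: continuous_subspaceT.
    apply: subclosed_compact (@compHaus_compact doubleton) _ => //.
    exact: (@discrete_closed bool).
  apply/seteqP; split=> [b Ub [c nUc /e_inj cb]|b nb].
    by apply: nUc; rewrite cb.
  by apply: contrapT => nUb; apply: nb; exists b.
exists (r (e false)), (r (e true)); split; [exact: rE|exact: rE|].
by apply/path_linkedP; exists r.
Qed.

Lemma path_point (a b : F doubleton) :
  Fsub F (closed_point (false : doubleton)) a ->
  Fsub F (closed_point (true : doubleton)) b ->
  path_linked R a b ->
  exists a : F (sub_compHaus (closed_point (false : doubleton))),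
    path_linked R
      (functor_map F (sub_incl (closed_point (false : doubleton))) a)
      (functor_map F (cst true : continuousType
         (sub_compHaus (closed_point (false : doubleton))) doubleton) a).
Proof.
move=> [a' _ <-] [b' _ <-] ab; exists a'.
pose zero : continuousType doubleton doubleton := cst false.
have cneg : continuous (negb : doubleton -> doubleton).
  by apply/continuousP => U _; exact: (@discrete_open bool).
pose neg : continuousType doubleton doubleton := mkcts cneg.
have valE c (x : sub_compHaus (closed_point (c : doubleton))) : val x = c.
  exact: set_valP x.
have := path_linked_map (functor_map F zero) ab.
have := path_linked_sym (path_linked_map (functor_map F neg) ab).
rewrite -!/((functor_map F _ \o functor_map F _) _) -!functor_map_comp.
set i0 := sub_incl (closed_point (false : doubleton)).
set i1 := sub_incl (closed_point (true : doubleton)).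
rewrite (_ : (zero \o i0 : continuousType _ _) = i0); last first.
  by apply/continuousEP => x; rewrite -[RHS]/(val x) valE.
(* Both the projection and the swap send 1 to 0, so the projected path ends where the reversed
   swapped path begins. *)
rewrite (_ : (zero \o i1 : continuousType _ _) = (neg \o i1)); last first.
  by apply/continuousEP => x; rewrite -[RHS]/(~~ val x) valE.
rewrite (_ : (neg \o i0 : continuousType _ _) = cst true); last first.
  by apply/continuousEP => x; rewrite -[LHS]/(~~ val x) valE.
by move=> /[swap]; exact: path_linked_trans.
Qed.

End implications.

(** * Redundant binary expansions of the points of [0,1] *)

Section binary_tree.
Variable R : realType.

(* A word [w], most recent digit first, encodes the interval
   [node_left w, node_left w + node_len w]; its two children are the left and
   the right two thirds of it. *)
Definition node_len (w : seq bool) : R := (2 / 3) ^+ size w.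

Fixpoint node_left (w : seq bool) : R :=
  if w is b :: w' then node_left w' + (if b then node_len w' / 3 else 0) else 0.

(** [k] stores a bit at every node, and the next digit is the bit at the node already reached; bits
    off the branch are ignored. *)
Fixpoint branch (k : cantor_cube (seq bool)) (n : nat) : seq bool :=
  if n is m.+1 then k (branch k m) :: branch k m else [::].

Let len n : R := (2 / 3) ^+ n.
Let left k n := node_left (branch k n).

Lemma node_len_gt0 w : 0 < node_len w.
Proof. by rewrite exprn_gt0 // divr_gt0. Qed.

Lemma size_branch k n : size (branch k n) = n.
Proof. by elim: n => //= n ->. Qed.

Lemma node_len_branch k n : node_len (branch k n) = len n.
Proof. by rewrite /node_len size_branch. Qed.

Lemma lenS n : len n.+1 = 2 / 3 * len n.
Proof. by rewrite /len exprS. Qed.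

Lemma len_small (e : R) : 0 < e -> exists n, len n < e.
Proof.
move=> e0; have /cvgr0Pnorm_lt : GRing.exp (2 / 3 : R) @ \oo --> (0 : R).
  by apply: cvg_expr; rewrite ger0_norm; lra.
move=> /(_ e e0) [n _ /(_ n (leqnn n)) nlt]; exists n.
by apply: le_lt_trans nlt; exact: ler_norm.
Qed.

(** The intervals are nested: left ends increase ([down]) and right ends decrease ([up]). Hence the
    supremum [value] exists and lies in all of them. *)
Lemma left_bounds k m n : left k n <= left k m + len m.
Proof.
have up i d : left k (i + d) + len (i + d) <= left k i + len i.
  elim: d => [|d IH]; first by rewrite addn0.
  apply: le_trans IH; rewrite addnS lenS /left /= node_len_branch.
  have := node_len_gt0 (branch k (i + d)); rewrite node_len_branch.
  by case: (k _) => ?; lra.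
have down i d : left k i <= left k (i + d).
  elim: d => [|d IH]; first by rewrite addn0.
  apply: le_trans IH _; rewrite addnS /left /= lerDl.
  by case: (k _) => //; rewrite divr_ge0 // ltW // node_len_gt0.
have len_ge0 i : 0 <= len i by rewrite -(node_len_branch k) ltW // node_len_gt0.
case: (leqP m n) => mn.
  by have := up m (n - m)%N; rewrite subnKC //; have := len_ge0 n; lra.
have := down n (m - n)%N; rewrite subnKC; last exact: ltnW.
by have := len_ge0 m; lra.
Qed.

Let value k := sup (range (left k)).

Lemma value_bounds k n : left k n <= value k <= left k n + len n.
Proof.
have hs : has_sup (range (left k)).
  split; first by exists (left k 0), 0%N.
  by exists (left k n + len n) => _ [m _ <-]; exact: left_bounds.
apply/andP; split; first by apply: (ub_le_sup hs.2); exists n.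
by apply: ge_sup hs.1 _ => _ [m _ <-]; exact: left_bounds.
Qed.

(** Two points common to all the intervals differ by at most every [len n], which tends to 0. *)
Lemma value_uniq k (x : R) :
  (forall n, left k n <= x <= left k n + len n) -> value k = x.
Proof.
move=> xP; apply/eqP; rewrite -subr_eq0 -normr_le0 leNgt; apply/negP.
move=> /len_small [n]; rewrite ltNge => /negP; apply.
have := xP n; have := value_bounds k n.
by rewrite ler_norml => /andP[? ?] /andP[? ?]; lra.
Qed.

(** The first [n] digits read only finitely many coordinates of [k], and each coordinate is locally
    constant. *)
Lemma branch_near k n : \forall k' \near k, branch k' n = branch k n.
Proof.
elim: n => [|n IH]; first exact: (@filterE _ (nbhs k)).
have kn : nbhs k [set k' : cantor_cube (seq bool) |
    k' (branch k n) = k (branch k n)].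
  have := @prod_compHaus_proj_continuous _ (fun=> doubleton) (branch k n) k.
  move=> /(_ [set k (branch k n)]); apply.
  apply: open_nbhs_nbhs; split; last exact: erefl.
  exact: (@discrete_open bool [set k (branch k n)]).
by apply: filterS2 IH kn => k' /= -> ->.
Qed.

Lemma value_continuous : continuous (value : cantor_cube (seq bool) -> R).
Proof.
move=> k; apply/cvgrPdist_lt => e e0; have [n ne] := len_small e0.
have := branch_near k n; apply: filterS => k' k'k.
have := value_bounds k n; have := value_bounds k' n.
rewrite /left k'k => /andP[? ?] /andP[? ?].
by rewrite ltr_norml; apply/andP; split; lra.
Qed.

Lemma value_itv k : value k \in (`[0, 1]%classic : set R).
Proof.
have := value_bounds k 0; rewrite /left /len /= expr0 add0r => v.
by rewrite inE /= in_itv.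
Qed.

Definition digits_value k : itv_compHaus R := SigSub (value_itv k).

Lemma digits_value_continuous : continuous digits_value.
Proof. by apply: continuous_set_type; exact: value_continuous. Qed.

(** For [x] in the interval of [w], these are the bits whose child still contains [x]; the remaining
    bound is inherited from the parent. *)
Definition allowed (x : itv_compHaus R) (w : seq bool) : set doubleton :=
  [set b | if b : bool then node_left w + node_len w / 3 <= val x
           else val x <= node_left w + node_len w * (2 / 3)].

Lemma allowed_digits_value (x : itv_compHaus R) k :
  (forall w, allowed x w (k w)) -> digits_value k = x.
Proof.
move=> kx; apply: val_inj; apply: value_uniq => n; rewrite /left.
elim: n => [|n].
  by have := set_valP x; rewrite /len /= in_itv /= expr0 add0r.
have := kx (branch k n); rewrite /allowed /= node_len_branch lenS.
by case: (k _) => ? /andP[? ?]; apply/andP; split; lra.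
Qed.

Lemma digits_value_surj (x : itv_compHaus R) : exists k, digits_value k = x.
Proof.
(* Go right whenever the right child permits it; otherwise [x] lies in the left third. *)
exists (fun w => node_left w + node_len w / 3 <= val x).
apply: allowed_digits_value => w; rewrite /allowed /=; case: ifPn => //.
by rewrite -ltNge; have := node_len_gt0 w; lra.
Qed.

End binary_tree.

(** * Milutin selection on [0,1] from a path *)

Lemma path_Milutin_interval (R : realType) (F : compFunctor)
    (a b : F doubleton) :
  admits_tensor_product F ->
  Fsub F (closed_point (false : doubleton)) a ->
  Fsub F (closed_point (true : doubleton)) b ->
  path_linked R a b ->
  absolute_Milutin F (itv_compHaus R).
Proof.
move=> [tensor [_ tensor_nat]] aF bF /path_linkedP [p [p0 p1]].
(* With z the relative position of x in the interval of [w], the affine map gives 3z - 1, which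
   clamps to 0 on the left third and to 1 on the right third. *)
pose slope w : R := 3 / node_len R w.
pose shift w : R := - (slope w * node_left R w + 1).
pose u w : continuousType (itv_compHaus R) (F doubleton) :=
  p \o mkcts (@affine_clamp_continuous R (slope w) (shift w)).
have cA x w : closed (allowed (R := R) x w) by exact: (@discrete_closed bool).
have uA x w : Fsub F (cA x w) (u w x).
  have l0 := node_len_gt0 R w.
  pose z := (val x - node_left R w) / node_len R w.
  have zE : val x = node_left R w + z * node_len R w.
    by rewrite divfK ?gt_eqF // addrC subrK.
  have -> : u w x = p (clamp (3 * z - 1)).
    rewrite -[LHS]/(p (clamp (slope w * val x + shift w))).
    by congr (p (clamp _)); rewrite /shift /slope /z; lra.
  (* In the outer thirds the law is [a] or [b], supported at an allowed bit; in the middle third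
     both bits are allowed, so any law will do. *)
  have [z1|z1] := leP z 3^-1.
    rewrite clamp0 ?p0; last by lra.
    apply: Fsub_subset aF => _ ->; rewrite /allowed /= zE; nra.
  have [z2|z2] := leP (2 / 3) z.
    rewrite clamp1 ?p1; last by lra.
    apply: Fsub_subset bF => _ ->; rewrite /allowed /= zE; nra.
  by apply: Fsub_full => -[]; rewrite /allowed /= zE; nra.
have cu : continuous ((fun x w => u w x) : itv_compHaus R ->
    prod_compHaus (fun _ : seq bool => F doubleton)).
  by apply: continuous_prod => w; exact: cts_fun.
exists (seq bool), (mkcts (@digits_value_continuous R)),
  (tensor (seq bool) (fun=> doubleton) \o mkcts cu).
split=> x; first exact: digits_value_surj.
apply: (Fsub_tensor tensor_nat (cA := cA x)) => [k|w]; last exact: uA.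
exact: allowed_digits_value.
Qed.

(** * The cycle of implications *)

Theorem theorem3p9 (R : realType) (F : compFunctor)
    (F_mono : monomorphic F)
    (F_cont : functionally_continuous F)
    (F_tensor : admits_tensor_product F) :
  [<-> (* (1) *) absolute_Milutin F (itv_compHaus R);
       (* (2) *) forall I : Type, absolute_Milutin F (tychonoff_cube R I);
       (* (3) *) forall X : compHaus,
                   absolute_extensor0 X -> absolute_valued_retract F X;
       (* (4) *) absolute_valued_retract F doubleton;
       (* (5) *) exists a b : F doubleton,
                   [/\ Fsub F (closed_point (false : doubleton)) a,
                       Fsub F (closed_point (true : doubleton)) b
                     & path_linked R a b];
       (* (6) *) exists a : F (sub_compHaus (closed_point (false : doubleton))),
                   path_linked R
                     (functor_map F
                       (sub_incl (closed_point (false : doubleton))) a)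
                     (functor_map F
                       (cst true : continuousType
                          (sub_compHaus (closed_point (false : doubleton)))
                          doubleton) a)].
Proof.
tfae.
- by move=> M I; exact: Milutin_prod.
- exact: Milutin_cube_valued_retract.
- by apply; exact: doubleton_AE0.
- exact: doubleton_retract_path.
- by move=> [a [b [aF bF ab]]]; exact: path_point aF bF ab.
- move=> [a aa]; apply: path_Milutin_interval F_tensor _ _ aa.
    by exists a.
  (* The constant map has values in {1}, so the endpoint of the path lies in F{1}. *)
  exact: Fsub_map_range.
Qed.
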